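(* Let $\mathbf A$ be a finite algebra from a congruence modular variety. If there are join irreducible congruences $\alpha,\beta\in\mathrm{Con}(\mathbf A)$ with $\beta\le\alpha$ such that the $(\alpha^-,\alpha)$-minimal sets have type 2 and the $(\beta^-,\beta)$-minimal sets have type 4, then $\mathrm{nuP}_{\mathbf A}=\mathsf P/\mathrm{poly}$.
   Context: A finite algebra has finite universe and finitely many basic operations. An $n$-ary circuit over $\mathbf A$ is a DAG with one output node, sources labelled by variables or constants from $A$, gates labelled by basic operations; size is nodes plus edges. A NuDFA over $\mathbf A$ is $(\{t_n\}_{n\ge1},\iota,S)$ with $t_n$ an $n$-ary circuit, $\iota:\{0,1\}\to A$, $S\subseteq A$, accepting $b\in\{0,1\}^n$ iff $t_n(\iota(b_1),\dots,\iota(b_n))\in S$; polynomial size means size of $t_n$ polynomial in $n$; $\mathrm{nuP}_{\mathbf A}$ is the class of languages over $\{0,1\}$ accepted by polynomial-size NuDFAs over $\mathbf A$. $\mathsf P/\mathrm{poly}$ is the class of languages recognized by polynomial-size Boolean circuit families over $\wedge,\vee,\neg$. A join irreducible congruence $\gamma$ has a unique lower cover $\gamma^-$. Minimal sets and types are in the sense of tame congruence theory. *)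

(* Defs.v *)
From mathcomp Require Import all_boot all_algebra.
Set Implicit Arguments. Unset Strict Implicit. Unset Printing Implicit Defensive.
Import GRing.Theory.

Record signature := Signature { sym : finType; arity : sym -> nat }.

Definition interp (sg : signature) (T : Type) :=
  forall s : sym sg, {ffun 'I_(arity s) -> T} -> T.

Inductive pterm (sg : signature) (T : Type) (n : nat) : Type :=
| PVar of 'I_n
| PCst of T
| PApp (s : sym sg) of {ffun 'I_(arity s) -> pterm sg T n}.

Fixpoint peval (sg : signature) (T : Type) (n : nat) (ops : interp sg T)
  (x : 'I_n -> T) (t : pterm sg T n) : T :=
  match t with
  | PVar i => x i
  | PCst c => c
  | PApp s args => ops s [ffun j => peval ops x (args j)]
  end.

Definition pol_op (sg : signature) (T : Type) (ops : interp sg T) (n : nat)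
  (g : ('I_n -> T) -> T) : Prop :=
  exists t : pterm sg T n, forall x, g x = peval ops x t.

Inductive term (sg : signature) : Type :=
| Var of nat
| App (s : sym sg) of {ffun 'I_(arity s) -> term sg}.

Fixpoint teval (sg : signature) (T : Type) (ops : interp sg T)
  (env : nat -> T) (t : term sg) : T :=
  match t with
  | Var i => env i
  | App s args => ops s [ffun j => teval ops env (args j)]
  end.

Definition satisfies (sg : signature) (T : Type) (ops : interp sg T)
  (Sigma : term sg -> term sg -> Prop) : Prop :=
  forall s t, Sigma s t -> forall env : nat -> T, teval ops env s = teval ops env t.

Definition is_congP (sg : signature) (B : Type) (ops : interp sg B)
  (th : B -> B -> Prop) : Prop :=
  [/\ (forall x, th x x), (forall x y, th x y -> th y x),
      (forall x y z, th x y -> th y z -> th x z) &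
      (forall (s : sym sg) (x y : {ffun 'I_(arity s) -> B}),
          (forall i, th (x i) (y i)) -> th (ops s x) (ops s y))].

Definition congP_meet (B : Type) (r s : B -> B -> Prop) : B -> B -> Prop :=
  fun x y => r x y /\ s x y.

Definition congP_join (sg : signature) (B : Type) (ops : interp sg B)
  (r s : B -> B -> Prop) : B -> B -> Prop :=
  fun x y => forall th, is_congP ops th ->
     (forall a b, r a b -> th a b) -> (forall a b, s a b -> th a b) -> th x y.

Definition con_modular (sg : signature) (B : Type) (ops : interp sg B) : Prop :=
  forall x y z, is_congP ops x -> is_congP ops y -> is_congP ops z ->
    (forall a b, x a b -> z a b) ->
    forall a b, congP_join ops x (congP_meet y z) a b <->
                congP_meet (congP_join ops x y) z a b.

Definition in_CM_variety (sg : signature) (A : Type) (opsA : interp sg A) : Prop :=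
  exists Sigma : term sg -> term sg -> Prop,
    satisfies opsA Sigma /\
    forall (B : Type) (opsB : interp sg B), satisfies opsB Sigma -> con_modular opsB.

Unset Implicit Arguments.
Section FinAlg.
Variables (sg : signature) (A : finType) (ops : interp sg A).

Definition is_cong (th : rel A) : Prop :=
  [/\ (forall x, th x x), (forall x y, th x y -> th y x),
      (forall x y z, th x y -> th y z -> th x z) &
      (forall (s : sym sg) (x y : {ffun 'I_(arity s) -> A}),
          (forall i, th (x i) (y i)) -> th (ops s x) (ops s y))].

Definition rle (r s : rel A) : Prop := forall x y, r x y -> s x y.
Definition req (r s : rel A) : Prop := forall x y, r x y = s x y.
Definition rlt (r s : rel A) : Prop := rle r s /\ ~ req r s.

Definition is_join (t1 t2 th : rel A) : Prop :=
  [/\ is_cong th, rle t1 th, rle t2 th &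
      forall w, is_cong w -> rle t1 w -> rle t2 w -> rle th w].

Definition join_irreducible (g : rel A) : Prop :=
  [/\ is_cong g, ~ req g (fun x y => x == y) &
      forall t1 t2, is_cong t1 -> is_cong t2 -> is_join t1 t2 g ->
        req t1 g \/ req t2 g].

Definition lower_cover (d g : rel A) : Prop :=
  [/\ is_cong d, is_cong g, rlt d g &
      forall t, is_cong t -> rlt d t -> rlt t g -> False].

Definition is_pol1 (f : A -> A) : Prop :=
  pol_op ops (n := 1) (fun x => f (x ord0)).

Definition UD (d g : rel A) (U : {set A}) : Prop :=
  exists f : A -> A, [/\ is_pol1 f, U = [set f x | x : A] &
                         exists a b, g a b /\ ~~ d (f a) (f b)].

Definition minimal_set (d g : rel A) (U : {set A}) : Prop :=
  UD d g U /\ forall V, UD d g V -> V \subset U -> V = U.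

Definition trace (d g : rel A) (U N : {set A}) : Prop :=
  exists2 b, b \in U &
    N = U :&: [set x | g b x] /\ exists x y, [/\ x \in N, y \in N & ~~ d x y].

(* The induced algebra A|_N (operations: the polynomials of A preserving N),
   factored by d restricted to N, is polynomially equivalent to the algebra
   (C, opsC); the universe N/d is identified with C via phi. *)
Definition quot_poly_equiv (d : rel A) (N : {set A})
  (sgC : signature) (C : Type) (opsC : interp sgC C) : Prop :=
  exists phi : A -> C,
  [/\ (forall c, exists2 x, x \in N & phi x = c),
      (forall x y, x \in N -> y \in N -> (phi x = phi y <-> d x y)) &
      forall n (g : ('I_n -> C) -> C),
        pol_op opsC g <->
        exists p : ('I_n -> A) -> A,
          [/\ pol_op ops p,
              (forall x, (forall i, x i \in N) -> p x \in N) &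
              (forall x, (forall i, x i \in N) -> phi (p x) = g (fun i => phi (x i)))]].

End FinAlg.
Arguments is_cong {sg A}.
Arguments is_join {sg A}.
Arguments join_irreducible {sg A}.
Arguments lower_cover {sg A}.
Arguments is_pol1 {sg A}.
Arguments UD {sg A}.
Arguments minimal_set {sg A}.
Arguments quot_poly_equiv {sg A} ops d N {sgC C}.
Arguments rle {A}.
Arguments req {A}.
Arguments rlt {A}.
Arguments trace {A}.
Set Implicit Arguments.

Definition argn (T : Type) (m : nat) (d : T) (x : {ffun 'I_m -> T}) (j : nat) : T :=
  match @insub nat (fun k => k < m) 'I_m j with Some k => x k | None => d end.

Definition latSig : signature := @Signature bool (fun _ => 2).
Definition latOps : interp latSig bool :=
  fun s x => if s then argn false x 0 && argn false x 1
             else argn false x 0 || argn false x 1.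

Definition vsArity (K : finFieldType) (s : (K + 'I_3)%type) : nat :=
  match s with inl _ => 1 | inr i => nth 0 [:: 2; 1; 0] i end.
Definition vsSig (K : finFieldType) : signature := @Signature (K + 'I_3)%type (@vsArity K).
Definition vsOps (K : finFieldType) : interp (vsSig K) K :=
  fun s x => match s with
             | inl k => k * argn 0 x 0
             | inr i => match val i with
                        | 0 => argn 0 x 0 + argn 0 x 1
                        | 1 => - argn 0 x 0
                        | _ => 0
                        end
             end%R.

Unset Implicit Arguments.
Section Types.
Variables (sg : signature) (A : finType) (ops : interp sg A).

Definition type2 (d g : rel A) : Prop :=
  forall U N, minimal_set ops d g U -> trace d g U N ->
    exists K : finFieldType, quot_poly_equiv ops d N (@vsOps K).

Definition type4 (d g : rel A) : Prop :=
  forall U N, minimal_set ops d g U -> trace d g U N ->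
    quot_poly_equiv ops d N latOps.
End Types.
Arguments type2 {sg A}.
Arguments type4 {sg A}.
Set Implicit Arguments.

(* An n-ary circuit is given as a straight-line program (a topologically
   sorted DAG): each node is an input variable, a constant, or a gate labelled
   by a basic operation whose inputs are (indices of) earlier nodes; the last
   node is the output. *)
Inductive cnode (sg : signature) (T : Type) (n : nat) : Type :=
| CIn of 'I_n
| CCst of T
| CGate (s : sym sg) of ('I_(arity s) -> nat).

Definition circuit (sg : signature) (T : Type) (n : nat) := seq (cnode sg T n).

Definition circ_wf (sg : signature) (T : Type) (n : nat) (c : circuit sg T n) : Prop :=
  0 < size c /\
  forall k, k < size c -> forall d : cnode sg T n,
    match nth d c k with
    | CGate s args => forall j, args j < k
    | _ => True
    end.

Definition node_edges (sg : signature) (T : Type) (n : nat) (nd : cnode sg T n) : nat :=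
  match nd with CGate s _ => arity s | _ => 0 end.

Definition circ_size (sg : signature) (T : Type) (n : nat) (c : circuit sg T n) : nat :=
  sumn [seq (node_edges nd).+1 | nd <- c].

Fixpoint circ_run (sg : signature) (T : Type) (n : nat) (ops : interp sg T)
  (dflt : T) (x : 'I_n -> T) (c : circuit sg T n) (acc : seq T) : seq T :=
  match c with
  | [::] => acc
  | nd :: c' =>
      let v := match nd with
               | CIn i => x i
               | CCst a => a
               | CGate s args => ops s [ffun j => nth dflt acc (args j)]
               end in
      circ_run ops dflt x c' (rcons acc v)
  end.

(* value of the output node (dflt is never used for well-formed circuits) *)
Definition circ_eval (sg : signature) (T : Type) (n : nat) (ops : interp sg T)
  (dflt : T) (c : circuit sg T n) (x : 'I_n -> T) : T :=
  last dflt (circ_run ops dflt x c [::]).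

Definition poly_size (sg : signature) (T : Type) (t : forall n, circuit sg T n) : Prop :=
  exists k : nat, forall n, 0 < n -> circ_size (t n) <= k * n ^ k + k.

(* languages over {0,1}; NuDFAs only read words of length n >= 1 *)
Definition language := seq bool -> bool.

Definition nuP (sg : signature) (A : finType) (ops : interp sg A) (L : language) : Prop :=
  exists (t : forall n, circuit sg A n) (iota : bool -> A) (S : {set A}),
  [/\ forall n, 0 < n -> circ_wf (t n),
      poly_size t &
      forall w : seq bool, 0 < size w ->
        L w = (circ_eval ops (iota false) (t (size w))
                 (fun i => iota (nth false w i)) \in S)].

Definition boolSig : signature :=
  @Signature (option bool) (fun s => if s is Some _ then 2 else 1).
Definition boolOps : interp boolSig bool :=
  fun s x => match s with
             | Some true => argn false x 0 && argn false x 1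
             | Some false => argn false x 0 || argn false x 1
             | None => ~~ argn false x 0
             end.

Definition no_consts (sg : signature) (T : Type) (n : nat) (c : circuit sg T n) : Prop :=
  forall k (d : cnode sg T n), k < size c ->
    match nth d c k with CCst _ => False | _ => True end.

Definition Ppoly (L : language) : Prop :=
  exists t : forall n, circuit boolSig bool n,
  [/\ forall n, 0 < n -> circ_wf (t n) /\ no_consts (t n),
      poly_size t &
      forall w : seq bool, 0 < size w ->
        L w = circ_eval boolOps false (t (size w)) (fun i => nth false w i)].

(* Main.v *)
Require Import Defs.
From mathcomp Require Import all_boot all_algebra.
From mathcomp Require Import boolp.
Set Implicit Arguments. Unset Strict Implicit. Unset Printing Implicit Defensive.

(* Minimal sets and traces of a prime quotient (d, g) suffice for both halves of
   tame congruence theory that are needed.  On a type 2 trace of alpha, an exact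
   Maltsev polynomial r gives s(x) = r(a0,x,a1), which swaps two elements a0, a1
   generating alpha.  On a type 4 trace N of beta, congruence modularity gives a
   polynomial k mapping all of A into N and fixing the two classes of N (the
   empty tail property).  As beta <= alpha, some unary polynomial followed by k
   separates a0 from a1 inside N; composing it with s yields the negated literal.
   Input bits encoded by a0, a1 thus give a bit and its negation in N, where
   meet and join are polynomials, and a Boolean circuit is simulated on pairs
   (value, negation).  The converse inclusion encodes an element of A by the
   Boolean vector indicating it. *)

(** * Polynomials and congruence modularity *)

(** Subterms are nested in a finite function; the explicit fixpoint supplies an induction hypothesis
    for each of them. *)
Lemma pterm_nested_ind (sg : signature) (T : Type) (n : nat)
    (P : pterm sg T n -> Prop) :
  (forall i, P (@PVar sg T n i)) -> (forall c, P (@PCst sg T n c)) ->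
  (forall s (args : {ffun _ -> pterm sg T n}),
     (forall j, P (args j)) -> P (@PApp sg T n s args)) ->
  forall t, P t.
Proof.
move=> Pvar Pcst Papp; fix IH 1; case=> [i|c|s args].
- exact: Pvar.
- exact: Pcst.
- by apply: Papp => j; apply: IH.
Qed.

Lemma term_nested_ind (sg : signature) (P : term sg -> Prop) :
  (forall i, P (@Var sg i)) ->
  (forall s (args : {ffun _ -> term sg}),
     (forall j, P (args j)) -> P (@App sg s args)) ->
  forall t, P t.
Proof.
move=> Pvar Papp; fix IH 1; case=> [i|s args]; first exact: Pvar.
by apply: Papp => j; apply: IH.
Qed.

Fixpoint psubst (sg : signature) (T : Type) (m n : nat)
    (u : 'I_m -> pterm sg T n) (t : pterm sg T m) : pterm sg T n :=
  match t with
  | PVar i => u i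
  | PCst c => @PCst sg T n c
  | PApp s args => @PApp sg T n s [ffun j => psubst u (args j)]
  end.

Section Polynomials.
Variables (sg : signature) (T : Type) (ops : interp sg T).
Arguments ops : clear implicits.

Lemma peval_psubst m n (u : 'I_m -> pterm sg T n) (t : pterm sg T m) x :
  peval ops x (psubst u t) = peval ops (fun i => peval ops x (u i)) t.
Proof.
elim/pterm_nested_ind: t => //= s args IH; congr (ops s).
by apply/ffunP => j; rewrite !ffunE.
Qed.

Lemma pol_comp m n (g : ('I_m -> T) -> T) (h : 'I_m -> ('I_n -> T) -> T) :
  pol_op ops g -> (forall i, pol_op ops (h i)) ->
  pol_op ops (fun x => g (fun i => h i x)).
Proof.
move=> [t gE] /choice[u uE]; exists (psubst u t) => x.
by rewrite gE peval_psubst; congr peval; apply/funext => i.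
Qed.

Lemma pol_basic (s : sym sg) :
  pol_op ops (fun x : 'I_(arity s) -> T => ops s [ffun j => x j]).
Proof.
exists (@PApp sg T _ s [ffun j => @PVar sg T _ j]) => x /=.
by congr (ops s); apply/ffunP => j; rewrite !ffunE.
Qed.

Lemma pol_proj n (i : 'I_n) : pol_op ops (fun x : 'I_n -> T => x i).
Proof. by exists (@PVar sg T n i). Qed.

Lemma pol_cst n (c : T) : pol_op ops (fun _ : 'I_n -> T => c).
Proof. by exists (@PCst sg T n c). Qed.

Lemma congP_pol (th : T -> T -> Prop) n (g : ('I_n -> T) -> T) x y :
  is_congP ops th -> pol_op ops g -> (forall i, th (x i) (y i)) ->
  th (g x) (g y).
Proof.
move=> [thr _ _ thc] [t gE] thxy; rewrite !gE.
elim/pterm_nested_ind: t {g gE} => //= s args IH.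
by apply: thc => j; rewrite !ffunE.
Qed.

Definition set_arg (s : sym sg) (z : {ffun 'I_(arity s) -> T})
    (j : 'I_(arity s)) (a : T) : {ffun 'I_(arity s) -> T} :=
  [ffun i => if i == j then a else z i].

(** The tuple [x] is turned into [y] one argument at a time through the hybrids [mix k]; each step
    is a translation, and transitivity chains the steps. *)
Lemma translations_congP (th : T -> T -> Prop) :
  (forall x, th x x) -> (forall x y, th x y -> th y x) ->
  (forall x y z, th x y -> th y z -> th x z) ->
  (forall s z j a b, th a b ->
     th (ops s (set_arg z j a)) (ops s (set_arg z j b))) ->
  is_congP ops th.
Proof.
move=> thr ths tht thc; split => // s x y thxy.
pose mix k := [ffun i : 'I_(arity s) => if i < k then y i else x i].
have step k : k <= arity s -> th (ops s x) (ops s (mix k)).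
  elim: k => [_|k IH lt_ks].
    by rewrite (_ : mix 0 = x) //; apply/ffunP => i; rewrite ffunE.
  apply: tht (IH (ltnW lt_ks)) _; set j := Ordinal lt_ks.
  rewrite (_ : mix k = set_arg (mix k) j (x j)); last first.
    apply/ffunP => i; rewrite !ffunE; case: eqP => // ->.
    by rewrite ltnn.
  rewrite (_ : mix k.+1 = set_arg (mix k) j (y j)); first exact: thc.
  apply/ffunP => i; rewrite !ffunE ltnS leq_eqVlt -val_eqE /=.
  by case: eqP => //= eq_ik; congr (y _); apply: val_inj.
rewrite (_ : y = mix (arity s)); first exact: step.
by apply/ffunP => i; rewrite ffunE ltn_ord.
Qed.

(** A syntactic congruence: two elements are related when no map of [Q] separates them modulo [E].
    Closure of [Q] under precomposition with translations gives compatibility. *)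
Lemma separation_congP (Q : (T -> T) -> Prop) (E : T -> T -> Prop) :
  (forall x, E x x) -> (forall x y, E x y -> E y x) ->
  (forall x y z, E x y -> E y z -> E x z) ->
  (forall q s z j, Q q -> Q (fun a => q (ops s (set_arg z j a)))) ->
  is_congP ops (fun x y => forall q, Q q -> E (q x) (q y)).
Proof.
move=> Er Es Et Qc; apply: translations_congP.
- by move=> x q _; apply: Er.
- by move=> x y xy q /xy; apply: Es.
- by move=> x y z xy yz q Qq; apply: Et (xy q Qq) (yz q Qq).
- by move=> s z j a b ab q Qq; apply: ab (Qc q s z j Qq).
Qed.

End Polynomials.

(** Index 2 falls outside the list, so [z] is read as the default of [nth]. *)
Definition pt3 (T : Type) (x y z : T) : 'I_3 -> T := fun i => nth z [:: x; y] i.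

(** * Modularity in the algebra of ternary polynomials *)

Section TernaryPolynomials.
Variables (sg : signature) (A : Type) (ops : interp sg A).
Arguments ops : clear implicits.

(** The ternary polynomial operations form a subalgebra of a power of [A], so they satisfy its
    identities and their congruences obey the modular law. *)
Definition tpol := {f : ('I_3 -> A) -> A | pol_op ops f}.

Lemma tpol_op_subproof (s : sym sg) (x : {ffun 'I_(arity s) -> tpol}) :
  pol_op ops (fun y => ops s [ffun j => sval (x j) y]).
Proof. exact: pol_comp (pol_basic ops s) (fun j => svalP (x j)). Qed.

Definition tpol_ops : interp sg tpol :=
  fun s x => exist _ _ (tpol_op_subproof x).

Lemma tpol_teval (env : nat -> tpol) (t : term sg) y :
  sval (teval tpol_ops env t) y = teval ops (fun k => sval (env k) y) t.
Proof.
elim/term_nested_ind: t => //= s args IH; congr (ops s).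
by apply/ffunP => j; rewrite !ffunE IH.
Qed.


Definition agree_on (S : ('I_3 -> A) -> Prop) (f g : tpol) : Prop :=
  forall y, S y -> sval f y = sval g y.

Lemma agree_on_congP S : is_congP tpol_ops (agree_on S).
Proof.
split=> [f y //|f g fg y /fg //|f g h fg gh y Sy|s x y xy z Sz].
  by rewrite fg // gh.
by rewrite /=; congr (ops s); apply/ffunP => i; rewrite !ffunE xy.
Qed.

Lemma tpol_satisfies Sigma : satisfies ops Sigma -> satisfies tpol_ops Sigma.
Proof.
move=> satA s t Sst env.
have E: sval (teval tpol_ops env s) = sval (teval tpol_ops env t).
  by apply/funext => y; rewrite !tpol_teval; apply: satA.
case: (teval _ env s) (teval _ env t) E => [f pf] [g pg] /= E.
exact: eq_exist.
Qed.

(* The modular law for the kernels of the evaluations at the points (x,x,z0)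
   (alpha), (z0,z1,z1) (beta) and (x,x,w) (gamma <= alpha), applied to the pair
   formed by the constant z0 and the third projection; this replaces an appeal
   to Day's terms. *)
Lemma CM_ternary_pol (c : A -> bool) (z0 z1 : A) :
  in_CM_variety ops -> c z0 != c z1 ->
  exists f : ('I_3 -> A) -> A,
    [/\ pol_op ops f, forall x, f (pt3 x x z0) = z0 &
        c (f (pt3 z0 z0 z1)) != c (f (pt3 z0 z1 z1))].
Proof.
move=> [Sigma [satA modV]] c01; apply: contrapT => noF.
pose al := agree_on (fun y => exists x, y = pt3 x x z0).
pose be := agree_on (fun y => y = pt3 z0 z1 z1).
pose ga := agree_on (fun y => exists x w, y = pt3 x x w).
pose pc : tpol := exist _ _ (pol_cst ops 3 z0).
pose px i : tpol := exist _ _ (pol_proj ops i).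
pose i0 : 'I_3 := ord0; pose i1 : 'I_3 := Ordinal (isT : 1 < 3).
pose i2 : 'I_3 := Ordinal (isT : 2 < 3).
have galal f g : ga f g -> al f g by move=> fg y [x ->]; apply: fg; exists x, z0.
have [_] := modV _ _ (tpol_satisfies satA) ga be al (agree_on_congP _)
  (agree_on_congP _) (agree_on_congP _) galal pc (px i2).
have rhs : congP_meet (congP_join tpol_ops ga be) al pc (px i2).
  split; last by move=> y [x ->].
  (* The chain from [pc] through the first and second projections to the third has links in [be],
     [ga], [be]. *)
  move=> th [_ _ tht _] gath beth.
  apply: (tht _ (px i0)); first by apply: beth => y ->.
  apply: (tht _ (px i1)); first by apply: gath => y [x [w ->]].
  by apply: beth => y ->.
move=> /(_ rhs) {rhs} join_c2.
pose chi (f : tpol) := c (sval f (pt3 z0 z0 z1)).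
(* Without the wanted polynomial, [chi] on the [al]-class of [pc] can equally be read at
   (z0,z1,z1). *)
have chiE f : al f pc -> chi f = c (sval f (pt3 z0 z1 z1)).
  move=> fc; apply/eqP; apply: contrapT => /negP ne; apply: noF.
  exists (sval f); split=> //; first exact: svalP.
  by move=> x; apply: fc; exists x.
(* [E] compares [chi] only inside the [al]-class of [pc]. Not being separated modulo [E] by any
   congruence-preserving map is a congruence, against which the join is tested. *)
pose E f g := (al f pc <-> al g pc) /\ (al f pc -> chi f = chi g).
pose Q (q : tpol -> tpol) := forall th, is_congP tpol_ops th ->
  forall f g, th f g -> th (q f) (q g).
have alP := agree_on_congP (fun y => exists x, y = pt3 x x z0).
have Eal f g : al f g -> (al f pc -> chi f = chi g) -> E f g.
  case: (alP) => _ als alt _ fg ?; split=> //; split; last exact: alt.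
  by apply: alt; apply: als.
have thP : is_congP tpol_ops (fun f g => forall q, Q q -> E (q f) (q g)).
  apply: separation_congP => //.
  - by move=> f g [fg chifg]; split=> [|/fg/chifg //]; split=> /fg.
  - move=> f g h [fg cfg] [gh cgh]; split; first by split=> [/fg/gh|/gh/fg].
    by move=> fc; rewrite cfg // cgh //; apply/fg.
  - move=> q s z j Qq th thc f g fg; apply: (Qq _ thc).
    case: thc => thr _ _; apply=> i; rewrite !ffunE; by case: eqP.
(* This congruence contains [ga], since [chi] reads a point (x,x,w), and the meet of [be] and [al],
   by [chiE]. So [pc] and the third projection get equal [chi], against [c01]. *)
have [||_ chi02] := join_c2 _ thP _ _ id (fun th thc f g fg => fg).
- move=> f g fg q Qq; have qfg := Qq _ (agree_on_congP _) _ _ fg.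
  apply: Eal; first exact: galal.
  by move=> _; congr c; apply: qfg; exists z0, z1.
- move=> f g [befg alfg] q Qq.
  have beq := Qq _ (agree_on_congP _) _ _ befg.
  have alq := Qq _ (agree_on_congP _) _ _ alfg.
  apply: Eal => // fc; rewrite chiE // chiE; first by congr c; apply: beq.
  by case: (alP) => _ als alt _; apply: alt fc; apply: als.
- have /eqP := chi02 (fun y _ => erefl); by apply/negP.
Qed.

End TernaryPolynomials.

(** * Minimal sets and traces *)

Section Congruences.
Variables (sg : signature) (A : finType) (ops : interp sg A).
Arguments ops : clear implicits.

Lemma pol1_id : is_pol1 ops id.
Proof. exact: pol_proj. Qed.

Lemma pol1_cst c : is_pol1 ops (fun _ => c).
Proof. exact: pol_cst. Qed.

Lemma pol1_pol n (g : ('I_n -> A) -> A) (h : 'I_n -> A -> A) :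
  pol_op ops g -> (forall i, is_pol1 ops (h i)) ->
  is_pol1 ops (fun x => g (fun i => h i x)).
Proof.
by move=> gP hP; apply: (@pol_comp _ _ _ _ _ _ (fun i x => h i (x ord0))).
Qed.

Lemma pol1_comp f g :
  is_pol1 ops f -> is_pol1 ops g -> is_pol1 ops (fun x => f (g x)).
Proof. by move=> fP gP; apply: (pol1_pol (h := fun _ => g) fP). Qed.

Lemma pol1_iter k f : is_pol1 ops f -> is_pol1 ops (iter k f).
Proof.
move=> fP; elim: k => [|k IH]; [exact: pol1_id | exact: pol1_comp fP IH].
Qed.

Lemma pol1_pt3 g (x y z : A -> A) :
  pol_op ops g -> is_pol1 ops x -> is_pol1 ops y -> is_pol1 ops z ->
  is_pol1 ops (fun a => g (pt3 (x a) (y a) (z a))).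
Proof.
move=> gP xP yP zP; apply: (pol1_pol (h := fun i a => pt3 (x a) (y a) (z a) i) gP).
by case=> [[|[|[|//]]]] /=.
Qed.


Lemma pol1_translation s z j : is_pol1 ops (fun a => ops s (set_arg z j a)).
Proof.
apply: (pol1_pol (h := fun i a => if i == j then a else z i) (pol_basic ops s)).
by move=> i; case: eqP => _; [apply: pol1_id | apply: pol1_cst].
Qed.

Lemma cong_pol1 (th : rel A) f x y :
  is_cong ops th -> is_pol1 ops f -> th x y -> th (f x) (f y).
Proof. by move=> thP fP xy; apply: (congP_pol (th := th) thP fP). Qed.

Lemma cong_separation (th : rel A) (Q : (A -> A) -> Prop) (E : A -> A -> Prop) :
  is_cong ops th ->
  (forall x, E x x) -> (forall x y, E x y -> E y x) ->
  (forall x y z, E x y -> E y z -> E x z) ->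
  (forall q p, Q q -> is_pol1 ops p -> Q (fun a => q (p a))) ->
  is_cong ops (fun x y => th x y && `[< forall q, Q q -> E (q x) (q y) >]).
Proof.
move=> [thr ths tht thc] Er Es Et Qc.
have [sr ss st sc] : is_congP ops (fun x y => forall q, Q q -> E (q x) (q y)).
  apply: separation_congP => // q s z j Qq.
  exact: Qc Qq (pol1_translation z j).
split.
- by move=> x; rewrite thr; apply/asboolP => q _; apply: Er.
- by move=> x y /andP[/ths-> /asboolP/ss ?]; apply/asboolP.
- move=> x y z /andP[xy /asboolP xy'] /andP[yz /asboolP yz'].
  by rewrite (tht _ _ _ xy yz); apply/asboolP; apply: st xy' yz'.
- move=> s x y xy; apply/andP; split; first by apply: thc => i; case/andP: (xy i).
  by apply/asboolP; apply: sc => i; case/andP: (xy i) => _ /asboolP.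
Qed.

Lemma cong_eq : is_cong ops (fun x y => x == y).
Proof.
split=> [x //|x y|x y z /eqP-> //|s x y xy]; first by rewrite eq_sym.
by apply/eqP; congr (ops s); apply/ffunP => i; apply/eqP.
Qed.

Lemma cong_meet (r s : rel A) :
  is_cong ops r -> is_cong ops s -> is_cong ops (fun x y => r x y && s x y).
Proof.
move=> [rr rs rt rc] [sr ss st sc]; split.
- by move=> x; rewrite rr sr.
- by move=> x y /andP[/rs-> /ss->].
- move=> x y z /andP[xy xy'] /andP[yz yz']; apply/andP.
  split; [exact: rt xy yz | exact: st xy' yz'].
- by move=> o x y xy; rewrite rc ?sc // => i; case/andP: (xy i).
Qed.

Lemma rlt_witness (r s : rel A) : rlt r s -> exists x y, s x y /\ ~~ r x y.
Proof.
move=> [rs nrs]; apply: contrapT => no; apply: nrs => x y.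
apply/idP/idP; first exact: rs.
by move=> sxy; apply: contrapT => /negP nr; apply: no; exists x, y.
Qed.

(** Coding relations as sets of pairs makes it possible to take a congruence of largest cardinality
    strictly below [g]. *)
Lemma lower_cover_exists (g : rel A) :
  is_cong ops g -> ~ req g (fun x y => x == y) -> exists d, lower_cover ops d g.
Proof.
move=> gP g0; pose R (S : {set A * A}) : rel A := fun x y => (x, y) \in S.
pose P S := `[< is_cong ops (R S) /\ rlt (R S) g >].
have R_set (t : rel A) : R [set u | t u.1 u.2] = t.
  by apply/funext => x; apply/funext => y; rewrite /R inE.
have P0 : P [set u | u.1 == u.2].
  apply/asboolP; rewrite (R_set (fun x y => x == y)); split; first exact: cong_eq.
  split; last by move=> gq; apply: g0 => x y; rewrite gq.
  by case: gP => gr _ _ _ x y /eqP->; apply: gr.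
case: (arg_maxnP (fun S : {set A * A} => #|S|) P0) => S /asboolP[SP Sg] Smax.
exists (R S); split=> // t tP St tg.
have [x [y [txy nSxy]]] := rlt_witness St.
have : #|S| < #|[set u | t u.1 u.2]|.
  apply: proper_card; apply/properP; split.
    by apply/subsetP => -[a b] Sab; rewrite inE; apply: St.1.
  by exists (x, y); rewrite // inE.
rewrite ltnNge; case/negP; apply: Smax; apply/asboolP; by rewrite R_set.
Qed.

Lemma lower_cover_between (d g t : rel A) :
  lower_cover ops d g -> is_cong ops t -> rle d t -> rle t g ->
  req t d \/ req t g.
Proof.
move=> [_ _ _ cov] tP dt tg; case: (pselect (req t d)) => [|ntd]; first by left.
right; apply: contrapT => ntg; apply: (cov t tP); split=> // dq.
by apply: ntd => x y; rewrite dq.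
Qed.

(** A congruence [w] above [d] and [t] meets [g] in a congruence that lies between [d] and [g] and
    contains (x,y), hence is [g]. So [g] is the join of [d] and [t], and irreducibility leaves only
    [t]. *)
Lemma join_irreducible_above (d g t : rel A) x y :
  join_irreducible ops g -> lower_cover ops d g -> is_cong ops t ->
  rle t g -> t x y -> ~~ d x y -> req t g.
Proof.
move=> [gP _ irr] dg tP tg txy ndxy; have [dP _ [dleg ndg] _] := dg.
case: (irr d t) => //; split=> // w wP dw tw.
have [] // := lower_cover_between dg (cong_meet wP gP).
- by move=> a b dab; rewrite dw ?dleg.
- by move=> a b /andP[].
- by move=> /(_ x y); rewrite (negPf ndxy) tw // tg.
by move=> wq a b gab; move: (wq a b); rewrite gab => /andP[].
Qed.

End Congruences.

(** Every cycle length is at most the cardinality of [A], so it divides the factorial. *)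
Lemma iter_fact_perm (A : finType) (U : {set A}) (h : A -> A) :
  {homo h : x / x \in U} -> {in U &, injective h} ->
  {in U, forall x, iter #|A|`! h x = x}.
Proof.
move=> hU hinj x xU.
have /dvdnP[k ->] : order h x %| #|A|`!.
  by rewrite dvdn_fact // order_gt0 max_card.
elim: k => // k IH; rewrite mulSn iterD IH.
exact: (iter_order_in (S := mem U)).
Qed.

Section MinimalSets.
Variables (sg : signature) (A : finType) (ops : interp sg A).
Variables (d g : rel A).
Hypothesis dg : lower_cover ops d g.

Let dP : is_cong ops d. Proof. by case: dg. Qed.
Let gP : is_cong ops g. Proof. by case: dg. Qed.

Lemma minimal_set_exists : exists U, minimal_set ops d g U.
Proof.
have UDT : `[< UD ops d g setT >].
  apply/asboolP; exists id; split; first exact: pol1_id.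
    by apply/setP => x; rewrite inE; apply/esym/imsetP; exists x.
  by have [_ _ /rlt_witness[a [b ab]] _] := dg; exists a, b.
case: (@arg_minnP _ setT (fun S => `[< UD ops d g S >]) (fun S => #|S|) UDT) => U /asboolP UU Umin.
exists U; split=> // V VV VU; apply/eqP; rewrite eqEcard VU.
by apply: Umin; apply/asboolP.
Qed.

Lemma trace_exists U : minimal_set ops d g U -> exists N, trace d g U N.
Proof.
move=> [[f [fP -> [a [b [gab ndab]]]]] _].
exists ([set f x | x : A] :&: [set x | g (f a) x]); exists (f a).
  by apply/imsetP; exists a.
split=> //; exists (f a), (f b); have [gr _ _ _] := gP.
split=> //; rewrite !inE ?gr ?andbT; try by apply/imsetP; eexists.
by rewrite (cong_pol1 gP) // andbT; apply/imsetP; exists b.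
Qed.

(** The pairs of [g] that no polynomial into [U] separates modulo [d] form a congruence between [d]
    and [g]. It is not [g], because of [f]; so it is [d], and some [h] into [U] separates [f a] from
    [f b]. By minimality [h] permutes [U], and a power of it is idempotent. *)
Lemma minimal_set_idempotent U : minimal_set ops d g U ->
  exists e, [/\ is_pol1 ops e, forall x, e x \in U & {in U, forall x, e x = x}].
Proof.
move=> [[f [fP UE [a [b [gab ndab]]]]] Umin]; have [dr ds dt _] := dP.
pose Q h := is_pol1 ops h /\ forall x, h x \in U.
have mP : is_cong ops (fun x y => g x y && `[< forall h, Q h -> d (h x) (h y) >]).
  apply: (cong_separation (E := fun x y => d x y)) => // q p [qP qU] pP.
  by split=> //; apply: pol1_comp.
have [||mq|mq] := lower_cover_between dg mP.
- move=> x y dxy; have [_ _ [dle _] _] := dg.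
  by rewrite dle //; apply/asboolP => q [qP _]; apply: (cong_pol1 dP qP).
- by move=> x y /andP[].
- have : ~~ d (f a) (f b) by [].
  rewrite -mq (cong_pol1 gP) //= => /asboolPn noh.
  have [h [[hP hU] ndh]] : exists h, Q h /\ ~~ d (h (f a)) (h (f b)).
    apply: contrapT => no; apply: noh => h Qh.
    by apply: contrapT => /negP nd; apply: no; exists h.
  have hUE : [set h x | x in U] = U.
    apply: Umin; last by apply/subsetP => _ /imsetP[x _ ->].
    exists (fun x => h (f x)); split; first exact: pol1_comp.
      by rewrite UE -imset_comp.
    by exists a, b.
  have hinj : {in U &, injective h} by apply/imset_injP; rewrite hUE.
  have hid := iter_fact_perm (fun x _ => hU x) hinj.
  exists (iter #|A|`! h); split=> //; first exact: pol1_iter.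
  by move=> x; case: #|A|`! (fact_gt0 #|A|) => // k _; apply: hU.
- have := mq a b; rewrite gab /= => /asboolP /(_ f) fd; move: ndab; rewrite fd //.
  by split=> // x; rewrite UE; apply/imsetP; exists x.
Qed.

(** Composed with the idempotent onto [U], [q] has image [q @: U] and still separates a pair of [g];
    minimality forces [q @: U = U]. *)
Lemma minimal_set_perm U q a b : minimal_set ops d g U ->
  is_pol1 ops q -> {homo q : x / x \in U} ->
  a \in U -> b \in U -> g a b -> ~~ d (q a) (q b) ->
  {in U, forall x, iter #|A|`! q x = x}.
Proof.
move=> UP qP qU aU bU gab ndq; have [e [eP eU eid]] := minimal_set_idempotent UP.
apply: iter_fact_perm => //; apply/imset_injP.
rewrite (_ : q @: U = U) //; apply: UP.2; last first.
  by apply/subsetP => _ /imsetP[x /qU xU ->].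
exists (fun x => q (e x)); split; first exact: pol1_comp.
  apply/setP => y; apply/imsetP/imsetP => -[x xU ->]; last by exists (e x).
  by exists x => //; rewrite eid.
by exists a, b; rewrite !eid.
Qed.

End MinimalSets.

(** * Minimal sets of types 2 and 4 *)

Lemma argnE (T : Type) (m : nat) (d : T) (x : {ffun 'I_m -> T}) (j : 'I_m) :
  argn d x j = x j.
Proof. by rewrite /argn; case: insubP => [u _ /val_inj->|]; rewrite ?ltn_ord. Qed.

Section VectorSpace.
Import GRing.Theory.
Local Open Scope ring_scope.
Variable K : finFieldType.

Lemma vs_pol_add : pol_op (@vsOps K) (fun x : 'I_2 -> K => x ord0 + x ord_max).
Proof.
exists (@PApp (vsSig K) K 2 (inr ord0) [ffun j => @PVar (vsSig K) K 2 j]) => x /=.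
set y := [ffun _ => _].
by rewrite (argnE 0 y (ord0 : 'I_2)) (argnE 0 y (ord_max : 'I_2)) !ffunE.
Qed.

Lemma vs_pol_opp : pol_op (@vsOps K) (fun x : 'I_1 -> K => - x ord0).
Proof.
pose i1 : 'I_3 := Ordinal (isT : (1 < 3)%N).
exists (@PApp (vsSig K) K 1 (inr i1) [ffun j => @PVar (vsSig K) K 1 j]) => x /=.
by set y := [ffun _ => _]; rewrite (argnE 0 y (ord0 : 'I_1)) !ffunE.
Qed.

Lemma vs_pol_maltsev :
  pol_op (@vsOps K) (fun x : 'I_3 -> K => x ord0 - x (inord 1) + x ord_max).
Proof.
have sub : pol_op (@vsOps K) (fun x : 'I_3 -> K => x ord0 - x (inord 1)).
  have neg := pol_comp vs_pol_opp (fun _ => pol_proj (@vsOps K) (inord 1 : 'I_3)).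
  apply: (pol_comp (h := fun i x => if i == ord0 then x ord0 else - x (inord 1))
            vs_pol_add) => i.
  by case: eqP => _; [apply: pol_proj | apply: neg].
apply: (pol_comp (h := fun i x => if i == ord0 then x ord0 - x (inord 1)
                                  else x ord_max) vs_pol_add) => i.
by case: eqP => _; [apply: sub | apply: pol_proj].
Qed.

End VectorSpace.

Section Type2.
Variables (sg : signature) (A : finType) (ops : interp sg A).
Variables (d g : rel A).
Hypothesis dg : lower_cover ops d g.

(* On the trace N the polynomial x - y + z is a Maltsev operation only modulo
   d; composing it with inverses of the permutations that it induces on the
   minimal set makes it satisfy r(x,y,y) = x and r(y,y,z) = z exactly. *)
Lemma type2_swap : type2 ops d g ->
  exists s a0 a1,
    [/\ is_pol1 ops s, g a0 a1, ~~ d a0 a1, s a0 = a1 & s a1 = a0].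
Proof.
move=> t2; have [U UP] := minimal_set_exists dg.
have [N NP] := trace_exists dg UP; have [K [phi [_ phi_d polE]]] := t2 U N UP NP.
have [e [eP eU eid]] := minimal_set_idempotent dg UP.
have [p [pP pN phip]] := (polE 3 _).1 (vs_pol_maltsev K).
have [b bU [NE [a0 [a1 [a0N a1N nd]]]]] := NP.
have [_ [gr gs gt _] _ _] := dg.
have NU x : x \in N -> x \in U by rewrite NE inE => /andP[].
have gN x y : x \in N -> y \in N -> g x y.
  by rewrite NE !inE => /andP[_ bx] /andP[_ by_]; apply: gt by_; apply: gs.
(* Applying [e] changes nothing on [N] but sends all of [A] into [U], as [fixU] demands. *)
pose P x y z := e (p (pt3 x y z)).
have pt3N x y z : x \in N -> y \in N -> z \in N -> forall i, pt3 x y z i \in N.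
  by move=> xN yN zN; case=> [[|[|[|//]]]].
have PN x y z : x \in N -> y \in N -> z \in N ->
    P x y z \in N /\ phi (P x y z) = (phi x - phi y + phi z)%R.
  move=> xN yN zN; have inN := pt3N _ _ _ xN yN zN.
  rewrite /P eid; last by apply/NU/pN.
  by split; [apply: pN | rewrite phip // /pt3 /= inordK].
pose M := #|A|`!.
(* Such a [q] is the identity on [N] modulo [d], so it keeps [a0] and [a1] apart and permutes [U];
   its iterate of order [M.-1] is then its inverse on [U]. *)
have fixU (q : A -> A) : is_pol1 ops q -> (forall x, q x \in U) ->
    (forall x, x \in N -> q x \in N /\ phi (q x) = phi x) ->
    {in U, forall x, iter M q x = x}.
  move=> qP qU qN; have [qa0 pa0] := qN _ a0N; have [qa1 pa1] := qN _ a1N.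
  apply: (minimal_set_perm dg UP qP (a := a0) (b := a1)); rewrite ?NU ?gN //.
  apply: contra nd => /(phi_d _ _ qa0 qa1); rewrite pa0 pa1.
  by move/(phi_d _ _ a0N a1N).
have M_gt0 : M = M.-1.+1 by rewrite prednK // fact_gt0.
have iterN k q x : (forall y, y \in N -> q y \in N /\ phi (q y) = phi y) ->
    x \in N -> iter k q x \in N /\ phi (iter k q x) = phi x.
  by move=> qN xN; elim: k => //= k [IN IE]; case: (qN _ IN) => ? ->.
(* The inverse of [u -> P u y y] is applied to the first argument, so that [q x y y = x]. *)
pose q x y z := P (iter M.-1 (fun u => P u y y) x) y z.
have PyyN y : y \in N ->
    forall x, x \in N -> P x y y \in N /\ phi (P x y y) = phi x.
  by move=> yN x xN; case: (PN x y y xN yN yN) => ? ->; rewrite GRing.subrK.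
have PyyP y : is_pol1 ops (fun u => P u y y).
  by apply: (pol1_comp eP); apply: pol1_pt3 => //;
    [apply: pol1_id | apply: pol1_cst | apply: pol1_cst].
have qyy x y : x \in U -> y \in N -> q x y y = x.
  move=> xU yN; rewrite /q -[P _ y y]/((fun u => P u y y) _) -iterS -M_gt0.
  by apply: fixU => // [u|]; [apply: eU | apply: PyyN].
have qN x y z : x \in N -> y \in N -> z \in N ->
    q x y z \in N /\ phi (q x y z) = (phi x - phi y + phi z)%R.
  move=> xN yN zN; have [iN iE] := iterN M.-1 _ _ (PyyN y yN) xN.
  by have [? ->] := PN _ _ _ iN yN zN; rewrite iE.
have qP (x y z : A -> A) : is_pol1 ops x -> is_pol1 ops y -> is_pol1 ops z ->
    is_pol1 ops (fun a => q (x a) (y a) (z a)).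
  move=> xP yP zP; apply: (pol1_comp eP); apply: pol1_pt3 => //.
  elim: M.-1 => //= k IH; apply: (pol1_comp eP); exact: pol1_pt3.
(* The inverse of [u -> q y y u] is applied to the third argument. It fixes [y], so the identity
   already obtained for [q] survives. *)
pose r x y z := q x y (iter M.-1 (fun u => q y y u) z).
have qyN y : y \in N -> forall z, z \in N -> q y y z \in N /\ phi (q y y z) = phi z.
  by move=> yN z zN; case: (qN y y z yN yN zN) => ? ->; rewrite GRing.subrr GRing.add0r.
have ryy z y : z \in U -> y \in N -> r y y z = z.
  move=> zU yN; rewrite /r -[q y y _]/((fun u => q y y u) _) -iterS -M_gt0.
  apply: fixU => //; last exact: qyN.
    by apply: qP; [apply: pol1_cst | apply: pol1_cst | apply: pol1_id].
  by move=> u; apply: eU.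
have rxy x y : x \in U -> y \in N -> r x y y = x.
  move=> xU yN; rewrite /r (_ : iter _ _ y = y) ?qyy //.
  by elim: M.-1 => //= k ->; rewrite qyy // NU.
(* In [r a0 x a1] the variable also occurs inside the iterated map. *)
have iterP k : is_pol1 ops (fun x => iter k (fun u => q x x u) a1).
  elim: k => [|k IH] /=; first exact: pol1_cst.
  by apply: qP IH; apply: pol1_id.
exists (fun x => r a0 x a1), a0, a1; split=> //; last 2 first.
- by rewrite ryy // NU.
- by rewrite rxy // NU.
- apply: qP; [exact: pol1_cst | exact: pol1_id | exact: iterP].
- exact: gN.
Qed.

End Type2.

Lemma lat_pol_op (s : bool) : pol_op latOps (fun x : 'I_2 -> bool =>
  if s then x ord0 && x ord_max else x ord0 || x ord_max).
Proof.
exists (@PApp latSig bool 2 s [ffun j => @PVar latSig bool 2 j]) => x /=.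
rewrite /latOps; set y := [ffun _ => _].
by rewrite (argnE false y (ord0 : 'I_2)) (argnE false y (ord_max : 'I_2)) !ffunE.
Qed.

Lemma lat_pol_monotone n (h : ('I_n -> bool) -> bool) (x y : 'I_n -> bool) :
  pol_op latOps h -> (forall i, x i ==> y i) -> h x ==> h y.
Proof.
move=> [t hE] xy; rewrite !hE; elim/pterm_nested_ind: t {h hE} => //= [c|s args IH].
  exact: implybb.
have mono j : argn false [ffun j => peval latOps x (args j)] j ==>
              argn false [ffun j => peval latOps y (args j)] j.
  by rewrite /argn; case: insub => // i; rewrite !ffunE.
move: (mono 0) (mono 1); rewrite /latOps.
by case: s args IH mono => args _ _; do 4!case: (argn _ _ _).
Qed.

Section Type4.
Variables (sg : signature) (A : finType) (ops : interp sg A).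
Variables (d g : rel A).
Hypothesis dg : lower_cover ops d g.

(* The values of a polynomial f with f(x,x,z0) = z0 at the points (x,x,z1) are
   congruent to z0 modulo g, so they stay in the trace for every x in A. *)
Lemma type4_retraction : in_CM_variety ops -> type4 ops d g ->
  exists (N : {set A}) (phi : A -> bool) (k : A -> A) (z0 z1 : A),
  [/\ g z0 z1, is_pol1 ops k, forall x, k x \in N & phi (k z0) != phi (k z1)] /\
  forall n (h : ('I_n -> bool) -> bool), pol_op latOps h ->
    exists p : ('I_n -> A) -> A,
      [/\ pol_op ops p,
          (forall x, (forall i, x i \in N) -> p x \in N) &
          (forall x, (forall i, x i \in N) -> phi (p x) = h (fun i => phi (x i)))].
Proof.
move=> CM t4; have [U UP] := minimal_set_exists dg.
have [N NP] := trace_exists dg UP; have [phi [phis phi_d polE]] := t4 U N UP NP.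
have [e [eP eU eid]] := minimal_set_idempotent dg UP.
have [b bU [NE _]] := NP; have [dP gP _ _] := dg; have [gr gs gt _] := gP.
have NU x : x \in N -> x \in U by rewrite NE inE => /andP[].
have gN x y : x \in N -> y \in N -> g x y.
  by rewrite NE !inE => /andP[_ bx] /andP[_ by_]; apply: gt by_; apply: gs.
have NI x y : x \in N -> g x y -> y \in U -> y \in N.
  by rewrite NE !inE => /andP[_ bx] xy ->; apply: gt xy.
have [z0 z0N z0E] := phis false; have [z1 z1N z1E] := phis true.
have [|f [fP fxx fne]] := @CM_ternary_pol _ _ ops (fun x => phi (e x)) z0 z1 CM.
  by rewrite /= !eid ?NU // z0E z1E.
pose F x := e (f x).
have FP : pol_op ops F := pol_comp eP (fun _ => fP).
have FgN a x : (forall i, g (pt3 a a z0 i) (x i)) -> F x \in N.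
  move=> ax; apply: (NI z0) => //; last exact: eU.
  have := cong_pol1 gP eP (congP_pol (th := g) gP fP ax).
  by rewrite fxx eid ?NU.
have FN a y : y \in N -> F (pt3 a a y) \in N.
  by move=> yN; apply: (FgN a); case=> [[|[|[|//]]]] ? //=; apply: gN.
have FN3 x : (forall i, x i \in N) -> F x \in N.
  by move=> xN; apply: (FgN z0) => i; apply: gN => //; case: i => [[|[|[|//]]]].
pose sec c := if c then z1 else z0.
have secN c : sec c \in N by case: c.
have secE c : phi (sec c) = c by case: c.
pose h (v : 'I_3 -> bool) := phi (F (fun i => sec (v i))).
(* Arguments in [N] may be replaced by their representatives [sec], since [F] respects [d]; hence
   [F] induces [h] on the quotient. *)
have hP : pol_op latOps h.
  apply/polE; exists F; split=> // x xN.
  apply/phi_d; [exact: FN3 | by apply: FN3 => i; apply: secN|].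
  by apply: (congP_pol (th := d) dP FP) => i; apply/phi_d; rewrite ?secE.
have hE x y z : h (pt3 x y z) = phi (F (pt3 (sec x) (sec y) (sec z))).
  by congr (phi (F _)); apply/funext; case=> [[|[|[|//]]]].
(* The values of [h] at 001, 011, 111 increase and the first two differ, so they are 0, 1, 1. Thus x
   -> F(x,x,z1) separates [z0] from [z1]. *)
have m1 : h (pt3 false false true) ==> h (pt3 false true true).
  by apply: lat_pol_monotone => //; case=> [[|[|[|//]]]].
have m2 : h (pt3 false true true) ==> h (pt3 true true true).
  by apply: lat_pol_monotone => //; case=> [[|[|[|//]]]].
exists N, phi, (fun x => F (pt3 x x z1)), z0, z1; split; last by move=> n h' /polE.
split=> //; first exact: gN.
- by apply: pol1_pt3 => //; [apply: pol1_id | apply: pol1_id | apply: pol1_cst].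
- by move=> x; apply: FN.
move: m1 m2 fne; rewrite !hE /= -/(F _) -/(F _).
by do 3!case: (phi _).
Qed.

End Type4.

(** * Circuits *)

Section Runs.
Variables (sg : signature) (T : Type) (ops : interp sg T) (dflt : T).
Arguments ops : clear implicits.
Variables (n : nat) (x : 'I_n -> T).
Implicit Types (c : circuit sg T n) (nd : cnode sg T n).

Definition node_value (acc : seq T) nd : T :=
  match nd with
  | CIn i => x i
  | CCst a => a
  | CGate s args => ops s [ffun j => nth dflt acc (args j)]
  end.

Definition node_values c : seq T := circ_run ops dflt x c [::].

Lemma circ_run_cat c1 c2 acc :
  circ_run ops dflt x (c1 ++ c2) acc =
  circ_run ops dflt x c2 (circ_run ops dflt x c1 acc).
Proof. by elim: c1 acc => //= nd c1 IH acc. Qed.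

Lemma node_values_rcons c nd :
  node_values (rcons c nd) = rcons (node_values c) (node_value (node_values c) nd).
Proof. by rewrite /node_values -cats1 circ_run_cat. Qed.

Lemma size_node_values c : size (node_values c) = size c.
Proof.
elim/last_ind: c => // c nd IH.
by rewrite node_values_rcons !size_rcons IH.
Qed.

Lemma nth_node_values_cat c1 c2 i : i < size c1 ->
  nth dflt (node_values (c1 ++ c2)) i = nth dflt (node_values c1) i.
Proof.
move=> lt_i; elim/last_ind: c2 => [|c2 nd IH]; first by rewrite cats0.
rewrite -rcons_cat node_values_rcons nth_rcons size_node_values size_cat.
by rewrite ltn_addr.
Qed.

Lemma circ_evalE c : circ_eval ops dflt c x = nth dflt (node_values c) (size c).-1.
Proof. by rewrite /circ_eval -nth_last -/(node_values c) size_node_values. Qed.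

End Runs.

(** * Emitting terms into circuits *)

Section Gadgets.
Variables (sg : signature) (T C : Type) (cst : C -> T) (ops : interp sg T) (dflt : T).
Arguments ops : clear implicits.

(* Terms over an arbitrary set of variables whose constants come from C; with
   C empty these are constant-free terms. *)
Inductive gadget (V : Type) : Type :=
| GVar of V
| GCst of C
| GApp (s : sym sg) of ('I_(arity s) -> gadget V).

Fixpoint geval (V : Type) (env : V -> T) (t : gadget V) : T :=
  match t with
  | GVar v => env v
  | GCst c => cst c
  | GApp s args => ops s [ffun j => geval env (args j)]
  end.

(** The number of nodes and edges added on emission; variables are free, as they refer to nodes
    already present. *)
Fixpoint gcost (V : Type) (t : gadget V) : nat :=
  match t with
  | GVar _ => 0
  | GCst _ => 1
  | GApp s args => (\sum_j gcost (args j)) + (arity s).+1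
  end.

(** Constants must lie in the image of [cst]: an empty [C] enforces constant-free circuits, while
    the identity allows all constants. *)
Definition node_ok n (k : nat) (nd : cnode sg T n) : Prop :=
  match nd with
  | CIn _ => True
  | CCst a => exists c, a = cst c
  | CGate s args => forall j, args j < k
  end.

Definition circ_ok n (c : circuit sg T n) : Prop :=
  forall k d, k < size c -> node_ok k (nth d c k).

Lemma circ_ok_rcons n (c : circuit sg T n) nd :
  circ_ok c -> node_ok (size c) nd -> circ_ok (rcons c nd).
Proof.
move=> cok ndok k d; rewrite size_rcons ltnS leq_eqVlt nth_rcons.
by case: ltnP => [lt_k _|_]; [apply: cok | rewrite orbF => /eqP->; rewrite eqxx].
Qed.

Lemma circ_size_rcons n (c : circuit sg T n) nd :
  circ_size (rcons c nd) = circ_size c + (node_edges nd).+1.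
Proof. by rewrite /circ_size map_rcons sumn_rcons. Qed.

Variables (X : Type) (n : nat) (inp : X -> 'I_n -> T).

(** The index [i] is fixed before the input [x] is chosen, so one circuit serves all inputs. *)
Definition computes (c : circuit sg T n) (i : nat) (F : X -> T) : Prop :=
  i < size c /\ forall x, nth dflt (node_values ops dflt (inp x) c) i = F x.

Lemma computes_cat c s i F : computes c i F -> computes (c ++ s) i F.
Proof.
move=> [lt_i iF]; split; first by rewrite size_cat ltn_addr.
by move=> x; rewrite nth_node_values_cat.
Qed.

Lemma computes_rcons c nd :
  computes (rcons c nd) (size c)
    (fun x => node_value ops dflt (inp x) (node_values ops dflt (inp x) c) nd).
Proof.
split=> [|x]; first by rewrite size_rcons.
by rewrite node_values_rcons nth_rcons size_node_values ltnn eqxx.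
Qed.

Implicit Types c : circuit sg T n.

Definition extends (c c' : circuit sg T n) (k : nat) :=
  [/\ circ_ok c', exists s, c' = c ++ s & circ_size c' <= circ_size c + k].

Lemma extends_refl c : circ_ok c -> extends c c 0.
Proof. by split=> //; [exists [::]; rewrite cats0 | rewrite addn0]. Qed.

Lemma extends_trans (c1 c2 c3 : circuit sg T n) k l :
  extends c1 c2 k -> extends c2 c3 l -> extends c1 c3 (k + l).
Proof.
move=> [_ [s c2E] le1] [ok [s' c3E] le2]; split=> //.
  by rewrite c3E c2E; exists (s ++ s'); rewrite catA.
by rewrite addnA (leq_trans le2) // leq_add2r.
Qed.

Lemma extends_rcons c nd : circ_ok c -> node_ok (size c) nd ->
  extends c (rcons c nd) (node_edges nd).+1.
Proof.
move=> cok ndok; split; first exact: circ_ok_rcons.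
  by exists [:: nd]; rewrite cats1.
by rewrite circ_size_rcons.
Qed.

Lemma extends_leq (c c' : circuit sg T n) k l : k <= l -> extends c c' k -> extends c c' l.
Proof. by move=> kl [? ? le]; split=> //; rewrite (leq_trans le) // leq_add2l. Qed.

Lemma extends_computes (c c' : circuit sg T n) k i F :
  extends c c' k -> computes c i F -> computes c' i F.
Proof. by move=> [_ [s ->] _]; apply: computes_cat. Qed.

Definition emittable V (t : gadget V) :=
  forall c (w : V -> nat) (F : V -> X -> T),
    circ_ok c -> (forall v, computes c (w v) (F v)) ->
    exists c' o, extends c c' (gcost t) /\
      computes c' o (fun x => geval (fun v => F v x) t).

(** Members are emitted one after another, and earlier outputs persist because circuits only grow at
    the end. Assuming [emittable] makes this usable for the arguments of a gate inside the induction
    of [emit]. *)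
Lemma emit_family_aux V (J : finType) (t : J -> gadget V) :
  (forall j, emittable (t j)) ->
  forall c (w : V -> nat) (F : V -> X -> T),
    circ_ok c -> (forall v, computes c (w v) (F v)) ->
    exists c' (o : J -> nat), extends c c' (\sum_j gcost (t j)) /\
      forall j, computes c' (o j) (fun x => geval (fun v => F v x) (t j)).
Proof.
move=> tE c w F cok wF.
suff [c' [o [cc' oE]]] : exists c' (o : J -> nat),
    extends c c' (\sum_(j <- index_enum J) gcost (t j)) /\
    forall j, j \in index_enum J ->
      computes c' (o j) (fun x => geval (fun v => F v x) (t j)).
  by exists c', o; split=> // j; apply: oE; rewrite mem_index_enum.
elim: (index_enum J) => [|j r [c1 [o [cc1 oE]]]].
  by exists c, (fun _ => 0); rewrite big_nil; split=> //; apply: extends_refl.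
have [c1ok _ _] := cc1.
have [v|c2 [i [c12 iE]]] := tE j c1 w F c1ok.
  exact: extends_computes cc1 (wF v).
exists c2, (fun j' => if j' == j then i else o j'); split.
  by rewrite big_cons addnC; apply: extends_trans cc1 c12.
move=> j'; rewrite inE; case: eqP => [-> _|_ /= j'r]; first exact: iE.
exact: extends_computes c12 (oE _ j'r).
Qed.

Lemma emit V (t : gadget V) : emittable t.
Proof.
elim: t => [v|a|s args IH] c w F cok wF.
- by exists c, (w v); split; [apply: extends_refl | apply: wF].
- exists (rcons c (@CCst sg T n (cst a))), (size c); split.
    by apply: extends_rcons => //; exists a.
  exact: computes_rcons.
have [c' [o [cc' oE]]] := emit_family_aux IH cok wF; have [c'ok _ _] := cc'.
exists (rcons c' (@CGate sg T n s o)), (size c'); split.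
  apply: extends_trans cc' _; apply: extends_rcons => // j.
  by case: (oE j).
case: (computes_rcons c' (@CGate sg T n s o)) => lt_i iE; split=> // x.
rewrite iE /=; congr (ops s); apply/ffunP => j; rewrite !ffunE.
by case: (oE j).
Qed.

Lemma emit_family V (J : finType) (t : J -> gadget V) c (w : V -> nat) F :
  circ_ok c -> (forall v, computes c (w v) (F v)) ->
  exists c' (o : J -> nat), extends c c' (\sum_j gcost (t j)) /\
    forall j, computes c' (o j) (fun x => geval (fun v => F v x) (t j)).
Proof. by apply: emit_family_aux => j; apply: emit. Qed.

(* Truncating a circuit after node i makes i its output. *)
Lemma computes_output c i F : circ_ok c -> computes c i F ->
  exists c', [/\ circ_ok c', 0 < size c', circ_size c' <= circ_size c &
    forall x, circ_eval ops dflt c' (inp x) = F x].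
Proof.
move=> cok [lt_i iF]; exists (take i.+1 c).
have sz : size (take i.+1 c) = i.+1 by rewrite size_takel.
split; rewrite ?sz //.
- move=> k d; rewrite sz => lt_k; rewrite nth_take //; apply: cok.
  exact: leq_trans lt_k lt_i.
- by rewrite -[X in _ <= circ_size X](cat_take_drop i.+1) /circ_size map_cat
    sumn_cat leq_addr.
- move=> x; rewrite circ_evalE sz /= -iF -[in RHS](cat_take_drop i.+1 c).
  by rewrite nth_node_values_cat // sz.
Qed.

End Gadgets.

(** * Simulation of circuits over one algebra by circuits over another *)

Section Simulation.
Variables (sg1 : signature) (T1 : finType) (ops1 : interp sg1 T1) (d1 : T1).
Variables (sg2 : signature) (T2 C : Type) (cst : C -> T2) (ops2 : interp sg2 T2).
Variables (d2 : T2) (in1 : bool -> T1) (in2 : bool -> T2).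
Arguments ops1 : clear implicits.
Variables (I : finType) (enc : T1 -> (I -> T2) -> Prop).
Variable input_gadget : I -> gadget sg2 C unit.
Variable const_gadget : T1 -> I -> gadget sg2 C unit.
Variable gate_gadget :
  forall s : sym sg1, I -> gadget sg2 C (option ('I_(arity s) * I)).
Local Notation geval := (geval cst ops2).

Hypothesis input_enc : forall b,
  enc (in1 b) (fun i => geval (fun _ => in2 b) (input_gadget i)).
Hypothesis const_enc : forall a b,
  enc a (fun i => geval (fun _ => in2 b) (const_gadget a i)).
Hypothesis gate_enc : forall s (a : {ffun 'I_(arity s) -> T1}) e b,
  (forall j, enc (a j) (e j)) ->
  enc (ops1 s a) (fun i => geval
    (fun v => if v is Some (j, i') then e j i' else in2 b) (gate_gadget s i)).

(** A bound for simulating one node of any kind; the successor pays for a fresh input node. *)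
Definition sim_cost : nat :=
  (\sum_i gcost (input_gadget i)).+1 + \sum_a \sum_i gcost (const_gadget a i) +
  \sum_s \sum_i gcost (gate_gadget s i).

Local Notation inp1 := (fun x i => in1 (x i)).
Local Notation inp2 := (fun x i => in2 (x i)).

(* Every node of the simulated circuit becomes a bundle of wires indexed by I;
   node 0 of the simulating circuit holds an input, from which gadgets without
   other arguments may build constants. *)
Lemma simulation_nodes n (c1 : circuit sg1 T1 n.+1) :
  (forall k d, k < size c1 ->
     if nth d c1 k is CGate s args then forall j, args j < k else True) ->
  exists c2 : circuit sg2 T2 n.+1,
  [/\ circ_ok cst c2, circ_size c2 <= 1 + sim_cost * size c1,
      computes ops2 d2 inp2 c2 0 (fun x => in2 (x ord0)) &
      forall k, k < size c1 -> exists (o : I -> nat) F,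
        (forall i, computes ops2 d2 inp2 c2 (o i) (F i)) /\
        forall x : 'I_n.+1 -> bool,
          enc (nth d1 (node_values ops1 d1 (inp1 x) c1) k) (fun i => F i x)].
Proof.
elim/last_ind: c1 => [_|c1 nd IH wf].
  exists [:: @CIn sg2 T2 n.+1 ord0]; split=> //; first by case.
have [k d lt_k|c2 [c2ok c2sz c2in c2E]] := IH.
  have := wf k d; rewrite size_rcons nth_rcons lt_k; apply.
  exact: leqW.
suff [c3 [o [F [c23 oF FE]]]] : exists c3 (o : I -> nat) F,
  [/\ extends cst c2 c3 sim_cost,
      forall i, computes ops2 d2 inp2 c3 (o i) (F i) &
      forall x, enc (node_value ops1 d1 (inp1 x) (node_values ops1 d1 (inp1 x) c1) nd)
        (fun i => F i x)].
  exists c3; have [c3ok _ c3sz] := c23; split=> //.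
  - rewrite size_rcons mulnS addnCA addnC (leq_trans c3sz) // leq_add2r //.
  - exact: extends_computes c23 c2in.
  - move=> k; rewrite size_rcons ltnS leq_eqVlt => /orP[/eqP->|lt_k].
      exists o, F; split=> // x.
      by rewrite node_values_rcons nth_rcons size_node_values ltnn eqxx.
    have [o' [F' [oF' FE']]] := c2E k lt_k; exists o', F'; split.
      by move=> i; apply: extends_computes c23 (oF' i).
    by move=> x; rewrite node_values_rcons nth_rcons size_node_values lt_k.
case: nd wf => [j|a|s args] wf.
- have wfin : computes ops2 d2 inp2 (rcons c2 (@CIn sg2 T2 n.+1 j)) (size c2)
      (fun x => in2 (x j)) by apply: computes_rcons.
  have ext := @extends_rcons _ _ _ cst _ c2 (@CIn sg2 T2 n.+1 j) c2ok Logic.I.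
  have [c2'ok _ _] := ext.
  have [c3 [o [c23 oE]]] := emit_family input_gadget c2'ok (fun _ => wfin).
  eexists c3, o, _; split; [|exact: oE|by move=> x; apply: input_enc].
  apply: extends_leq (extends_trans ext c23).
  by rewrite /sim_cost -addnA leq_addr.
- have [c3 [o [c23 oE]]] := emit_family (const_gadget a) c2ok (fun _ => c2in).
  eexists c3, o, _; split; [|exact: oE|by move=> x; apply: const_enc].
  apply: extends_leq c23; rewrite /sim_cost (bigD1 a) //=.
  by rewrite -!addnA addnCA leq_addr.
have lt_args j : args j < size c1.
  have := wf (size c1) (@CGate sg1 T1 n.+1 s args); rewrite size_rcons.
  by rewrite nth_rcons ltnn eqxx; apply.
have /choice[o' /choice[F' oF']] := fun j => c2E _ (lt_args j).
have wE v : computes ops2 d2 inp2 c2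
    (if v is Some (j, i) then o' j i else 0)
    (fun x : 'I_n.+1 -> bool => if v is Some (j, i) then F' j i x else in2 (x ord0)).
  by case: v => [[j i]|] //; case: (oF' j).
have [c3 [o [c23 oE]]] := emit_family (gate_gadget s) c2ok wE.
eexists c3, o, _; split; [|exact: oE|].
  apply: extends_leq c23; rewrite /sim_cost [X in _ + X](bigD1 s) //=.
  by rewrite addnCA leq_addr.
move=> x /=.
apply: (gate_enc (e := fun j i => F' j i x)) => j; rewrite ffunE.
by case: (oF' j).
Qed.

(** The decoding gadget [out] is emitted on the bundle of the last node and made the output. [K]
    does not depend on [n], so polynomial size is preserved. *)
Lemma simulation (out : gadget sg2 C (option I)) :
  exists K, forall n (c1 : circuit sg1 T1 n), 0 < n -> circ_wf c1 ->
  exists c2 : circuit sg2 T2 n,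
  [/\ circ_ok cst c2, 0 < size c2, circ_size c2 <= K * circ_size c1 + K &
      forall x, exists e b, enc (circ_eval ops1 d1 c1 (inp1 x)) e /\
        circ_eval ops2 d2 c2 (inp2 x) =
        geval (fun v => if v is Some i then e i else in2 b) out].
Proof.
exists (sim_cost + (gcost out).+1) => -[//|n] c1 _ [sz1 wf1].
have [k d lt_k|c2 [c2ok c2sz c2in c2E]] := @simulation_nodes n c1.
  by have := wf1 k lt_k d; case: nth.
have [|o [F [oF FE]]] := c2E (size c1).-1; first by rewrite prednK.
have wE v : computes ops2 d2 inp2 c2 (if v is Some i then o i else 0)
    (fun x : 'I_n.+1 -> bool => if v is Some i then F i x else in2 (x ord0)).
  by case: v.
have [c3 [i [[c3ok _ c3sz] iE]]] := emit out c2ok wE.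
have [c4 [c4ok c4sz c4le c4E]] := computes_output c3ok iE.
exists c4; split=> //.
  apply: (leq_trans c4le); apply: (leq_trans c3sz).
  have le : size c1 <= circ_size c1.
    by rewrite /circ_size; elim: (c1) => //= nd c IH; rewrite addSn ltnS
      (leq_trans IH) // leq_addl.
  apply: leq_trans (leq_add c2sz (leqnn _)) _.
  rewrite addnC addnA addn1 addnC mulnDl -addnA leq_add ?leq_mul //.
  by rewrite addnCA addnA leq_addl.
move=> x; exists (F^~ x), (x ord0); split; last exact: c4E.
by rewrite circ_evalE.
Qed.

End Simulation.

(** In [poly_size] one number is coefficient, exponent and additive constant; [K * k + K + k] is
    large enough for all three. *)
Lemma poly_size_bound K k n m :
  0 < n -> m <= k * n ^ k + k ->
  K * m + K <= (K * k + K + k) * n ^ (K * k + K + k) + (K * k + K + k).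
Proof.
move=> n_gt0 le_m; apply: leq_trans (leq_add (leq_mul (leqnn K) le_m) (leqnn K)) _.
rewrite mulnDr mulnA -addnA leq_add //; last by rewrite leq_addr.
by rewrite leq_mul ?leq_pexp2l ?leq_addl // -addnA leq_addr.
Qed.

(** * The two inclusions *)

Section Transfer.
Variables (sg1 : signature) (T1 : Type) (ops1 : interp sg1 T1) (d1 : T1).
Variables (sg2 : signature) (T2 C : Type) (cst : C -> T2) (ops2 : interp sg2 T2).
Variables (d2 : T2) (in1 : bool -> T1) (in2 : bool -> T2).
Variables (acc1 : T1 -> bool) (acc2 : T2 -> bool).

Lemma circuit_family_transfer (t1 : forall n, circuit sg1 T1 n) K :
  (forall n (c1 : circuit sg1 T1 n), 0 < n -> circ_wf c1 ->
    exists c2 : circuit sg2 T2 n,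
    [/\ circ_ok cst c2, 0 < size c2, circ_size c2 <= K * circ_size c1 + K &
      forall x : 'I_n -> bool,
        acc2 (circ_eval ops2 d2 c2 (fun i => in2 (x i))) =
        acc1 (circ_eval ops1 d1 c1 (fun i => in1 (x i)))]) ->
  (forall n, 0 < n -> circ_wf (t1 n)) -> poly_size t1 ->
  exists t2 : forall n, circuit sg2 T2 n,
  [/\ forall n, 0 < n -> circ_wf (t2 n) /\ circ_ok cst (t2 n), poly_size t2 &
    forall w : seq bool, 0 < size w ->
      acc2 (circ_eval ops2 d2 (t2 (size w)) (fun i => in2 (nth false w i))) =
      acc1 (circ_eval ops1 d1 (t1 (size w)) (fun i => in1 (nth false w i)))].
Proof.
move=> sim wf1 [k t1k].
pose good n (c2 : circuit sg2 T2 n) := 0 < n ->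
  [/\ circ_ok cst c2, 0 < size c2, circ_size c2 <= K * circ_size (t1 n) + K &
    forall x : 'I_n -> bool,
      acc2 (circ_eval ops2 d2 c2 (fun i => in2 (x i))) =
      acc1 (circ_eval ops1 d1 (t1 n) (fun i => in1 (x i)))].
have ex n : exists c2, @good n c2.
  (* Length 0 is unconstrained and receives the empty circuit. *)
  case: (posnP n) => [n0|n_gt0]; first by exists [::]; rewrite /good n0.
  by have [c2 c2P] := sim n (t1 n) n_gt0 (wf1 n n_gt0); exists c2.
exists (fun n => sval (cid (ex n))); split.
- move=> n n_gt0; have [ok sz _ _] := svalP (cid (ex n)) n_gt0.
  split=> //; split=> // j lt_j d.
  by have := ok j d lt_j; case: nth.
- exists (K * k + K + k) => n n_gt0; have [_ _ le _] := svalP (cid (ex n)) n_gt0.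
  by apply: leq_trans le _; apply: poly_size_bound => //; apply: t1k.
- move=> w w_gt0; have [_ _ _] := svalP (cid (ex (size w))) w_gt0.
  by move=> /(_ (fun i => nth false w i)).
Qed.

End Transfer.

(** * From the algebra to Boolean circuits *)

Section BooleanGadgets.
Variable V : Type.
Local Notation gadget := (gadget boolSig void V).
Implicit Types (t u : gadget) (env : V -> bool).
Local Notation geval := (geval (@of_void bool) boolOps).

Definition gneg t : gadget := @GApp boolSig void V None (fun _ => t).
Definition gbin (s : bool) t u : gadget :=
  @GApp boolSig void V (Some s) (fun j : 'I_2 => if j == ord0 then t else u).
(** Boolean circuits here have no constants, so truth values are made as t or not t, and t and not
    t. In [gfold] they serve as neutral elements. *)
Definition gbool (c : bool) t : gadget := gbin (~~ c) t (gneg t).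
Definition gfold (s : bool) t (r : seq gadget) : gadget :=
  foldr (gbin s) (gbool s t) r.

Lemma geval_neg env t : geval env (gneg t) = ~~ geval env t.
Proof.
rewrite /= /boolOps; set y := [ffun _ => _].
by rewrite (argnE false y (ord0 : 'I_1)) ffunE.
Qed.

Lemma geval_bin env s t u : geval env (gbin s t u) =
  if s then geval env t && geval env u else geval env t || geval env u.
Proof.
rewrite /= /boolOps; set y := [ffun _ => _].
rewrite (argnE false y (ord0 : 'I_2)) (argnE false y (ord_max : 'I_2)) !ffunE.
by case: s @y.
Qed.

Lemma geval_bool env c t : geval env (gbool c t) = c.
Proof. by rewrite geval_bin geval_neg; case: c (geval env t) => -[]. Qed.

Lemma geval_fold env s t r : geval env (gfold s t r) =
  if s then all (geval env) r else has (geval env) r.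
Proof.
elim: r => [|u r IH]; first by rewrite geval_bool; case: s.
by rewrite [LHS]geval_bin IH; case: s IH.
Qed.

End BooleanGadgets.

(** Wire [i] of a bundle is on exactly when the simulated value is [i]. Since [A] and the signature
    are finite, every basic operation has a gadget of size independent of the word length. *)
Lemma nuP_Ppoly (sg : signature) (A : finType) (ops : interp sg A) L :
  nuP ops L -> Ppoly L.
Proof.
move=> [t [iota [S [twf tpoly tL]]]].
pose enc (a : A) (e : A -> bool) := forall i, e i = (a == i).
pose var := @GVar boolSig void unit tt.
pose inG i := gbin false (gbin true var (gbool (iota true == i) var))
                (gbin true (gneg var) (gbool (iota false == i) var)).
pose cstG (a i : A) := gbool (a == i) var.
(* Disjunctive normal form: some argument tuple [f] with value [i] matches all the argument
   bundles. *)
pose gateG (s : sym sg) (i : A) :=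
  let none := @GVar boolSig void (option ('I_(arity s) * A)) None in
  gfold false none [seq gfold true none
      [seq GVar _ _ (Some (j, f j)) | j <- enum 'I_(arity s)]
    | f : {ffun 'I_(arity s) -> A} <- enum {ffun 'I_(arity s) -> A} & ops s f == i].
pose outG := gfold false (GVar boolSig void None)
  [seq GVar boolSig void (Some a) | a <- enum S].
have inGE b : enc (iota b)
    (fun i => geval (@of_void bool) boolOps (fun _ => b) (inG i)).
  move=> i; rewrite geval_bin !(geval_bin, geval_neg, geval_bool) /=.
  by case: b; rewrite ?orbF.
have cstE a (b : bool) : enc a
    (fun i => geval (@of_void bool) boolOps (fun _ => b) (cstG a i)).
  by move=> i; rewrite geval_bool.
have gateE (s : sym sg) (a : {ffun 'I_(arity s) -> A}) e (b : bool) :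
    (forall j, enc (a j) (e j)) ->
    enc (ops s a) (fun i => geval (@of_void bool) boolOps
      (fun v => if v is Some (j, i') then e j i' else b) (gateG s i)).
  move=> ea i; rewrite geval_fold has_map.
  have lineE (f : {ffun 'I_(arity s) -> A}) : geval (@of_void bool) boolOps
      (fun v => if v is Some (j, i') then e j i' else b)
      (gfold true (GVar boolSig void None)
         [seq GVar boolSig void (Some (j, f j)) | j <- enum 'I_(arity s)]) = (a == f).
    rewrite geval_fold all_map; apply/allP/eqP => [af|af j _ /=].
      by apply/ffunP => j; have := af j; rewrite mem_enum /= ea => /(_ isT)/eqP.
    by rewrite ea af.
  apply/hasP/eqP => [[f]|<-].
    by rewrite mem_filter /= lineE => /andP[/eqP<- _] /eqP->.
  exists a; first by rewrite mem_filter mem_enum eqxx.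
  exact: etrans (lineE a) (eqxx a).
have [K sim] := @simulation _ _ ops (iota false) _ _ _ _ boolOps false iota id
  _ enc _ _ _ inGE cstE gateE outG.
have [n c1 n_gt0 c1wf|t2 [t2wf t2p t2E]] :=
    @circuit_family_transfer _ _ ops (iota false) _ _ _ (@of_void bool) boolOps false
      iota id (fun v => v \in S) id t K _ twf tpoly.
  have [c2 [ok sz le c2E]] := sim n c1 n_gt0 c1wf; exists c2; split=> // x.
  have [e [b [ea ->]]] := c2E x; rewrite geval_fold has_map.
  apply/hasP/idP => [[a]|vS].
    by rewrite mem_enum /= ea => aS /eqP->.
  by eexists; [rewrite mem_enum; apply: vS | rewrite /= ea].
exists t2; split=> //.
- move=> n /t2wf[wf ok]; split=> // k d lt_k.
  by have := ok k d lt_k; case: nth => // a [[]].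
- by move=> w w_gt0; rewrite tL //; apply/esym/t2E.
Qed.

(** * From literals and lattice operations to Boolean circuits *)

Fixpoint gadget_of_pterm (sg : signature) (T V : Type) n (f : 'I_n -> V)
    (t : pterm sg T n) : gadget sg T V :=
  match t with
  | PVar i => @GVar sg T V (f i)
  | PCst c => @GCst sg T V c
  | PApp s args => @GApp sg T V s (fun j => gadget_of_pterm f (args j))
  end.

Lemma geval_gadget_of_pterm (sg : signature) (T V : Type) (ops : interp sg T)
    n (f : 'I_n -> V) (t : pterm sg T n) env :
  geval id ops env (gadget_of_pterm f t) = peval ops (fun i => env (f i)) t.
Proof.
elim/pterm_nested_ind: t => //= s args IH; congr (ops _).
by apply/ffunP => j; rewrite !ffunE.
Qed.

(* A bit v is carried by a pair of elements of N, one representing v and one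
   representing its negation; the lattice operations then suffice, since
   negation swaps the two components. *)
Lemma Ppoly_nuP_of_literals (sg : signature) (A : finType) (ops : interp sg A)
    (N : {set A}) (phi : A -> bool) (iota : bool -> A) (lit : bool -> A -> A)
    (lat : bool -> ('I_2 -> A) -> A) L :
  (forall i, is_pol1 ops (lit i)) ->
  (forall i b, lit i (iota b) \in N /\ phi (lit i (iota b)) = (b == i)) ->
  (forall s, pol_op ops (lat s)) ->
  (forall s x, (forall i, x i \in N) -> lat s x \in N /\ phi (lat s x) =
     if s then phi (x ord0) && phi (x ord_max)
     else phi (x ord0) || phi (x ord_max)) ->
  Ppoly L -> nuP ops L.
Proof.
move=> /choice[litT litTE] litE /choice[latT latTE] latE [t [twf tpoly tL]].
pose enc (v : bool) (e : bool -> A) :=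
  forall i, e i \in N /\ phi (e i) = (v == i).
pose inG i := gadget_of_pterm (fun _ => tt) (litT i).
pose cstG (a i : bool) : gadget sg A unit :=
  @GCst sg A unit (lit i (iota a)).
pose gateG (s : sym boolSig) :
    bool -> gadget sg A (option ('I_(@arity boolSig s) * bool)) :=
  match s return bool -> gadget sg A (option ('I_(@arity boolSig s) * bool)) with
  (* De Morgan: the positive wire uses the operation itself, the negative wire its dual, whence the
     index [b == i]. *)
  | Some b => fun i => gadget_of_pterm (fun j : 'I_2 => Some (j, i)) (latT (b == i))
  | None => fun i => @GVar sg A _ (Some (ord0 : 'I_1, ~~ i))
  end.
have inGE b : enc b (fun i => geval id ops (fun _ => iota b) (inG i)).
  by move=> i; rewrite geval_gadget_of_pterm -(litTE i (fun _ => iota b)).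
have cstE (a b : bool) : enc a (fun i => geval id ops (fun _ => iota b) (cstG a i)).
  by move=> i; apply: litE.
have gateE (s : sym boolSig) (a : {ffun 'I_(@arity boolSig s) -> bool}) e b :
    (forall j, enc (a j) (e j)) ->
    enc (boolOps a) (fun i => geval id ops
      (fun v => if v is Some (j, i') then e j i' else iota b) (gateG s i)).
  case: s a e => [s|] a e ea i /=.
    rewrite geval_gadget_of_pterm -latTE.
    have [|? ->] := latE (s == i) (fun j => e j i); first by move=> j; case: (ea j i).
    split=> //; rewrite (argnE false a (ord0 : 'I_2)) (argnE false a (ord_max : 'I_2)).
    rewrite (ea (ord0 : 'I_2) i).2 (ea (ord_max : 'I_2) i).2.
    move: (a (ord0 : 'I_2)) (a (ord_max : 'I_2)) => u v.
    by case: (s) (i) u v => -[] [] [].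
  rewrite (argnE false a (ord0 : 'I_1)); have [? ->] := ea (ord0 : 'I_1) (~~ i).
  by split=> //; case: (i) (a _) => -[].
have [K sim] := @simulation _ _ boolOps false _ _ _ _ ops (iota false) id iota
  (* The output is read from the positive wire. *)
  _ enc _ _ _ inGE cstE gateE (GVar sg A (Some true)).
have [n c1 n_gt0 c1wf|n /twf[]//|t2 [t2wf t2p t2E]] :=
    @circuit_family_transfer _ _ boolOps false _ _ _ id ops (iota false)
      id iota id phi t K _ _ tpoly.
  have [c2 [ok sz le c2E]] := sim n c1 n_gt0 c1wf; exists c2; split=> // x.
  by have [e [b [ev ->]]] := c2E x; rewrite /= (ev true).2 eqb_id.
exists t2, iota, [set x | phi x]; split=> [n /t2wf[]//|//|w w_gt0].
by rewrite inE t2E // tL.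
Qed.

Section Separation.
Variables (sg : signature) (A : finType) (ops : interp sg A).

(* The congruence generated by (a0,a1) is alpha, so it contains (z0,z1). *)
Lemma join_irreducible_separation (alpha alpham : rel A) (k : A -> A)
    (phi : A -> bool) a0 a1 z0 z1 :
  join_irreducible ops alpha -> lower_cover ops alpham alpha ->
  alpha a0 a1 -> ~~ alpham a0 a1 -> alpha z0 z1 -> phi (k z0) != phi (k z1) ->
  exists p, is_pol1 ops p /\ phi (k (p a0)) != phi (k (p a1)).
Proof.
move=> irr cov a01 na01 z01 k01; apply: contrapT => no.
(* If no polynomial followed by [k] separated [a0] from [a1], the congruence defined by these maps
   would contain (a0,a1), hence be [alpha], and [k] would not separate [z0] from [z1]. *)
pose Q (q : A -> A) := exists2 p, is_pol1 ops p & q = fun x => k (p x).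
have [alphaP _ _] := irr.
have thP : is_cong ops (fun x y =>
    alpha x y && `[< forall q, Q q -> phi (q x) = phi (q y) >]).
  apply: (cong_separation (E := fun x y => phi x = phi y)) => //.
    by move=> x y z -> ->.
  move=> _ p [p' p'P ->] pP; exists (fun x => p' (p x)) => //.
  exact: pol1_comp.
have th01 : alpha a0 a1 && `[< forall q, Q q -> phi (q a0) = phi (q a1) >].
  rewrite a01; apply/asboolP => _ [p pP ->]; apply/eqP.
  by apply: contrapT => /negP ne; apply: no; exists p.
have below : rle (fun x y =>
    alpha x y && `[< forall q, Q q -> phi (q x) = phi (q y) >]) alpha.
  by move=> x y /andP[].
have := join_irreducible_above irr cov thP below th01 na01 z0 z1.
rewrite z01 /= => /asboolP /(_ k) kE.
by move: k01; rewrite kE ?eqxx //; exists id => //; apply: pol1_id.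
Qed.

End Separation.
Unset Implicit Arguments.

Theorem mainTheorem15 (sg : signature) (A : finType) (ops : interp sg A)
  (alpha beta : rel A) :
  in_CM_variety ops ->
  join_irreducible ops alpha ->
  join_irreducible ops beta ->
  rle beta alpha ->
  (forall alpham, lower_cover ops alpham alpha -> type2 ops alpham alpha) ->
  (forall betam, lower_cover ops betam beta -> type4 ops betam beta) ->
  forall L : language, nuP ops L <-> Ppoly L.
Proof.
move=> CM irra irrb ba t2 t4 L; split; first exact: nuP_Ppoly.
have [alphaP alpha0 _] := irra; have [betaP beta0 _] := irrb.
have [alpham cova] := lower_cover_exists alphaP alpha0.
have [betam covb] := lower_cover_exists betaP beta0.
have [s [a0 [a1 [sP a01 na01 s0 s1]]]] := type2_swap cova (t2 _ cova).
have [N [phi [k [z0 [z1 [[z01 kP kN kne] polE]]]]]] :=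
  type4_retraction covb CM (t4 _ covb).
have [p [pP pne]] :=
  join_irreducible_separation (k := k) (phi := phi) irra cova a01 na01 (ba _ _ z01) kne.
have /choice[lat latP] := fun b => polE 2 _ (lat_pol_op b).
pose iota b := if b then a1 else a0.
(* As [phi] of [k (p a0)] and [k (p a1)] differ, x -> k(p x) reads the input bit or its negation,
   according to its value at [a1]; the swap [s] provides the other literal. *)
pose lit i x := k (p (if i == phi (k (p a1)) then x else s x)).
apply: (@Ppoly_nuP_of_literals sg A ops N phi iota lit lat).
- move=> i; apply: (pol1_comp kP); apply: (pol1_comp pP).
  by case: eqP => _ //; apply: pol1_id.
- move=> i b; split; first exact: kN.
  rewrite /lit /iota; move: pne.
  case E1: (phi (k (p a1))); case E0: (phi (k (p a0))) => // _;
  by case: i b => -[] /=; rewrite ?s0 ?s1 ?E0 ?E1.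
- by move=> b; case: (latP b).
- by move=> b x xN; case: (latP b) => _ latN latE; split; [apply: latN | apply: latE].
Qed.
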